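(* Let $X$ be a (real) Banach space containing a complemented subspace isomorphic to $c_0$. Then for every $0<\varepsilon<1$ there exists an equivalent norm $|\cdot|$ on $X$ such that: (i) $(X,|\cdot|)$ has the slice diameter two property, that is, every slice of the closed unit ball $B_{(X,|\cdot|)}$ has $|\cdot|$-diameter $2$. (ii) There are non-empty relatively weakly open subsets of $B_{(X,|\cdot|)}$ of arbitrarily small $|\cdot|$-diameter. (iii) $(X,|\cdot|)$ is $(r,s)$-SQ for all $0<r,s<\frac{1-\varepsilon}{1+\varepsilon}$, that is, for all such $r,s$ and every finite set $\{x_1,\ldots,x_n\}\subseteq S_{(X,|\cdot|)}$ there exists $y\in S_{(X,|\cdot|)}$ satisfying $|rx_i+sy|\le 1$ and $|rx_i-sy|\leq 1$ for every $i\in\{1,\dots,n\}$.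
   Context: All Banach spaces are real. $B_{(X,|\cdot|)}$ and $S_{(X,|\cdot|)}$ denote the closed unit ball and the unit sphere of $X$ for the norm $|\cdot|$. Given a bounded set $C\subseteq X$, a slice of $C$ is a set of the form $S(C,x^*,\alpha):=\{x\in C: x^*(x)>\sup x^*(C)-\alpha\}$ for some $x^*\in X^*$ and $\alpha>0$. The diameter of $C$ is $\sup\{|x-x'|: x,x'\in C\}$. A set is relatively weakly open in $C$ if it is open in $C$ for the restriction of the weak topology of $X$. *)

(* Defs.v *)
From HB Require Import structures.
From mathcomp Require Import all_boot all_order all_algebra.
From mathcomp Require Import all_classical all_reals all_analysis.

Set Implicit Arguments.
Unset Strict Implicit.
Unset Printing Implicit Defensive.

Import Order.TTheory GRing.Theory Num.Theory.
Import numFieldNormedType.Exports.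

Local Open Scope classical_set_scope.
Local Open Scope ring_scope.

Section c0_space.
Variable R : realType.

Definition null_sequence : {pred nat -> R} :=
  [pred u : nat -> R | `[< u @ \oo --> (0 : R) >]].

Lemma null_sequence_submod_closed : submod_closed null_sequence.
Proof.
split; first by apply/asboolP; exact: cvg_cst.
move=> a u v /asboolP u0 /asboolP v0; apply/asboolP.
rewrite -[X in _ --> X](_ : a * 0 + 0 = 0); last by rewrite mulr0 addr0.
by apply: (cvgD _ v0); apply: cvgM => //; exact: cvg_cst.
Qed.

HB.instance Definition _ := GRing.isSubmodClosed.Build R (nat -> R)
  null_sequence null_sequence_submod_closed.

Record c0 : Type := C0 { c0_val :> nat -> R; _ : c0_val \in null_sequence }.

HB.instance Definition _ := [isSub for c0_val].
HB.instance Definition _ := [Choice of c0 by <:].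
HB.instance Definition _ := [SubChoice_isSubLmodule of c0 by <:].

Lemma c0_cvg (u : c0) : c0_val u @ \oo --> (0 : R).
Proof. by case: u => u /= /asboolP. Qed.

Definition c0_norm (u : c0) : R := sup (range (fun n => `|u n|)).

Lemma c0_has_sup (u : c0) : has_sup (range (fun n => `|u n|)).
Proof.
split; first by exists `|u 0|; exists 0.
have /cvg_seq_bounded/pinfty_ex_gt0[M _ uM] : cvgn (c0_val u).
  by apply/cvg_ex; exists 0; exact: c0_cvg.
by exists M => _ [n _ <-]; exact: uM.
Qed.

Lemma c0_norm_ub (u : c0) n : `|u n| <= c0_norm u.
Proof. by apply: (sup_upper_bound (c0_has_sup u)); exists n. Qed.

Lemma c0_norm_le (u : c0) (M : R) : (forall n, `|u n| <= M) -> c0_norm u <= M.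
Proof.
move=> uM; apply: ge_sup; first exact: (c0_has_sup u).1.
by move=> _ [n _ <-].
Qed.

Lemma c0_ler_normD (u v : c0) : c0_norm (u + v) <= c0_norm u + c0_norm v.
Proof.
apply: c0_norm_le => n; apply: (le_trans (ler_normD (u n) (v n))).
by apply: lerD; exact: c0_norm_ub.
Qed.

Lemma c0_normrZ (a : R) (u : c0) : c0_norm (a *: u) = `|a| * c0_norm u.
Proof.
apply/eqP; rewrite eq_le; apply/andP; split.
  apply: c0_norm_le => n; rewrite [X in `|X|](_ : _ = a * u n) // normrM.
  by apply: ler_wpM2l => //; exact: c0_norm_ub.
have [->|a0] := eqVneq a 0.
  rewrite normr0 mul0r.
  exact: le_trans (normr_ge0 _) (c0_norm_ub (0 *: u) 0).
rewrite -ler_pdivlMl ?normr_gt0 //; apply: c0_norm_le => n.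
rewrite ler_pdivlMl ?normr_gt0 // -normrM.
exact: (c0_norm_ub (a *: u) n).
Qed.

Lemma c0_normr0_eq0 (u : c0) : c0_norm u = 0 -> u = 0.
Proof.
move=> u0; apply: val_inj; apply/funext => n /=.
by apply/eqP; rewrite -normr_le0 -u0; exact: c0_norm_ub.
Qed.

HB.instance Definition _ := Lmodule_isNormed.Build R c0
  c0_ler_normD c0_normrZ c0_normr0_eq0.

End c0_space.

Definition isomorphic_to_subspace (R : realType) (E X : normedModType R)
    (Y : set X) : Prop :=
  exists T : {linear E -> X}, range T = Y /\
    exists c C : R, [/\ 0 < c, 0 < C &
      forall u : E, c * `|u| <= `|T u| /\ `|T u| <= C * `|u|].

(* The range of a bounded linear projection is a closed linear subspace. *)
Definition complemented_subspace (R : realType) (X : normedModType R)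
    (Y : set X) : Prop :=
  exists P : {linear X -> X},
    [/\ continuous P, forall x, P (P x) = P x & range P = Y].

Section dual_and_weak_topology.
Variables (R : realType) (X : normedModType R).

Definition dual : Type := {f : {scalar X} | continuous (f : X -> R)}.
HB.instance Definition _ := gen_eqMixin dual.
HB.instance Definition _ := gen_choiceMixin dual.

Definition dual_fun (f : dual) : X -> R := sval f.
Coercion dual_fun : dual >-> Funclass.

Definition evaluation (x : X) : {ptws dual -> R} := fun f => f x.

Definition weak_space : Type := initial_topology evaluation.
HB.instance Definition _ := Topological.on weak_space.

(* weak_space is convertible to X, so open sets of weak_space are sets of X. *)
Definition relatively_weakly_open (C W : set X) : Prop :=
  exists2 U : set weak_space, open U & W = C `&` U.

End dual_and_weak_topology.

(* A second norm on X is a plain function N : X -> R. As an equivalent norm has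
   the same continuous functionals as the given one, dual and weak_space need
   not be redefined for N. *)
Section renorming.
Variables (R : realType) (X : normedModType R).
Implicit Types (N : X -> R) (C : set X).

Definition is_norm N : Prop :=
  [/\ forall x y, N (x + y) <= N x + N y,
      forall (a : R) x, N (a *: x) = `|a| * N x
    & forall x, N x = 0 -> x = 0].

Definition equivalent_norm N : Prop :=
  is_norm N /\
  exists c C : R, [/\ 0 < c, 0 < C &
    forall x, c * `|x| <= N x /\ N x <= C * `|x|].

Definition unit_ball N : set X := [set x | N x <= 1].

Definition unit_sphere N : set X := [set x | N x = 1].

Definition diameter N C : \bar R :=
  ereal_sup [set (N (x - y))%:E | x in C & y in C].

Definition slice C (f : dual X) (alpha : R) : set X :=
  [set x | C x /\ sup (f @` C) - alpha < f x].

Definition slice_diameter_two_property N : Prop :=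
  forall (f : dual X) (alpha : R), 0 < alpha ->
    diameter N (slice (unit_ball N) f alpha) = 2%:E.

Definition small_relatively_weakly_open_sets N : Prop :=
  forall delta : R, 0 < delta ->
    exists W : set X, [/\ relatively_weakly_open (unit_ball N) W,
      W !=set0 & (diameter N W < delta%:E)%E].

Definition rs_square (r s : R) N : Prop :=
  forall (n : nat) (x : 'I_n -> X), (forall i, unit_sphere N (x i)) ->
    exists2 y, unit_sphere N y &
      forall i, N (r *: x i + s *: y) <= 1 /\ N (r *: x i - s *: y) <= 1.

End renorming.

(* Main.v *)
Require Import Defs.
From HB Require Import structures.
From mathcomp Require Import all_boot all_order all_algebra.
From mathcomp Require Import all_classical all_reals all_analysis.
From mathcomp Require Import ring lra.

Import Order.TTheory GRing.Theory Num.Theory.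
Import numFieldNormedType.Exports.

Local Open Scope classical_set_scope.
Local Open Scope ring_scope.

Set Implicit Arguments.
Unset Strict Implicit.
Unset Printing Implicit Defensive.

(* Up to equivalence X = c0 (+)_oo Z, with coordinates u_n on c0. Coordinate 0 is
   called the root and the other ones are split into infinite blocks according to
   the 2-adic valuation of the index. The new unit ball is the closed absolutely
   convex hull of the unit balls B_i of R e_0 (+) c0(block i) and of the thick part
   D = {|u| <= 1, |u_0| <= 1 - eps, |z| <= 1 - eps}.
   (i) Every slice meets some B_i or D, where infinitely many coordinates can be
   changed freely to 1 or -1; as f(e_j) is small for some of them, the slice
   contains two points differing by 2 e_j, and the new norm dominates the sup norm.
   (ii) The hull of the B_i is, off the root, the unit ball of an l_1-sum of copies
   of c0. Thus if u_0 is close to 1 (which makes the share of D negligible) and k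
   blocks have a coordinate of almost 1/k, then every block has norm at most about
   1/k, and so has the difference of two such points.
   (iii) If x is in the unit ball and j is large, then r x + s e_j and r x - s e_j
   lie in D. *)

(** * Unit vectors of the space of null sequences *)

Section c0_units.
Variable R : realType.
Implicit Types (u v : c0 R) (a : R).

Lemma c0D u v n : (u + v) n = u n + v n. Proof. by []. Qed.
Lemma c0Z a u n : (a *: u) n = a * u n. Proof. by []. Qed.
Lemma c0N u n : (- u) n = - u n. Proof. by []. Qed.

Lemma c0_coord_le u n : `|u n| <= `|u|.
Proof. exact: c0_norm_ub. Qed.

Lemma c0_unit_subproof j : (fun n => (n == j)%:R : R) \in @null_sequence R.
Proof.
apply/asboolP; apply: cvg_near_cst; exists j.+1 => // n /= jn.
by rewrite gtn_eqF.
Qed.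

Definition c0_unit j : c0 R := C0 (c0_unit_subproof j).

Lemma c0_unitE j n : c0_unit j n = (n == j)%:R. Proof. by []. Qed.

Lemma norm_c0_unit j : `|c0_unit j| = 1.
Proof.
apply/eqP; rewrite eq_le; apply/andP; split.
  by apply: c0_norm_le => n; rewrite c0_unitE; case: eqP; rewrite ?normr1 ?normr0.
by have := c0_coord_le (c0_unit j) j; rewrite c0_unitE eqxx normr1.
Qed.

Definition c0_coord n (u : c0 R) : R := u n.

Lemma c0_coord_is_linear n : scalar (c0_coord n).
Proof. by []. Qed.

HB.instance Definition _ n := GRing.isLinear.Build R (c0 R) R _ (c0_coord n)
  (c0_coord_is_linear n).

(* Signed sums of m unit vectors have norm at most 1, so a functional that is at
   least eta on all of them in absolute value has norm at least m * eta. *)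
Lemma c0_units_weakly_null (f : {scalar c0 R}) (K : R) (h : nat -> nat)
    (eta : R) : injective h -> (forall u, `|f u| <= K * `|u|) -> 0 < eta ->
  exists k, `|f (c0_unit (h k))| < eta.
Proof.
move=> h_inj fK eta0; apply/not_existsP => large.
have {}large k : eta <= `|f (c0_unit (h k))| by rewrite leNgt; exact/negP.
pose w m := \sum_(k < m) Num.sg (f (c0_unit (h k))) *: c0_unit (h k).
have wE m n : w m n = \sum_(k < m) Num.sg (f (c0_unit (h k))) * (n == h k)%:R.
  rewrite /w -[LHS]/(c0_coord n _) linear_sum; apply: eq_bigr => k _.
  by rewrite linearZ.
have w_le1 m : `|w m| <= 1.
  apply: c0_norm_le => n; rewrite wE.
  have [[k /eqP nk]|n_h] := pselect (exists k : 'I_m, n == h k).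
    rewrite (bigD1 k) //= big1 ?addr0 => [|k' k'k].
      by rewrite nk eqxx mulr1 normr_sg; case: (_ != _).
    rewrite nk (negbTE (_ : h k != h k')) ?mulr0 //.
    by apply: contra k'k => /eqP/h_inj kk'; apply/eqP/val_inj.
  rewrite big1 ?normr0// => k _; rewrite (negbTE (_ : n != h k)) ?mulr0 //.
  by apply/negP => nk; apply: n_h; exists k.
have fw m : m%:R * eta <= f (w m).
  rewrite linear_sum /= mulr_natl -[m in _ *+ m]card_ord -sumr_const.
  by apply: ler_sum => k _; rewrite linearZ /= -normrEsg.
have := fw (Num.truncn (K / eta)).+1; apply/negP; rewrite -ltNge.
apply: (@le_lt_trans _ _ K).
  apply: (le_trans (ler_norm _)); apply: (le_trans (fK _)).
  rewrite ler_piMr // -[K]mulr1 -(norm_c0_unit 0).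
  exact: le_trans (fK _).
by rewrite -ltr_pdivrMr // truncnS_gt.
Qed.

End c0_units.

(** * The largest seminorm that is at most 1 on a given set *)

Section largest_seminorm.
Variables (R : realType) (X : lmodType R).
Implicit Types (p : X -> R) (G : set X).

Definition seminorm p : Prop :=
  (forall x y, p (x + y) <= p x + p y) /\ (forall a x, p (a *: x) = `|a| * p x).

Lemma seminorm_ge0 p x : seminorm p -> 0 <= p x.
Proof.
move=> [pD pZ]; have := pD x (- x); rewrite subrr -[X in p X](scale0r x) pZ.
by rewrite normr0 mul0r -scaleN1r pZ normrN1 mul1r -mulr2n pmulrn_lge0.
Qed.

Lemma seminormN p x : seminorm p -> p (- x) = p x.
Proof. by move=> [_ pZ]; rewrite -scaleN1r pZ normrN1 mul1r. Qed.

Lemma seminormB p x y : seminorm p -> p (x - y) <= p x + p y.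
Proof. by move=> pS; rewrite -(seminormN y pS); exact: pS.1. Qed.

Lemma seminorm_sum p (m : nat) (F : 'I_m -> X) :
  seminorm p -> p (\sum_(i < m) F i) <= \sum_(i < m) p (F i).
Proof.
move=> pS; elim/big_ind2 : _ => // [|x a y b xa yb].
  by rewrite -(scale0r 0) pS.2 normr0 mul0r.
by rewrite (le_trans (pS.1 _ _)) // lerD.
Qed.

Definition bounded_seminorm G p : Prop :=
  seminorm p /\ (forall x, G x -> p x <= 1).

(* For absorbing G this is the gauge of the closed absolutely convex hull of G. *)
Definition largest_seminorm G (x : X) : R :=
  sup [set p x | p in bounded_seminorm G].

Variable G : set X.
Hypothesis G_absorbing : forall x, exists2 t : R, 0 < t & G (t *: x).
Local Notation N := (largest_seminorm G).

(** Absorption makes the supremum finite: if t x is in [G] with t > 0, every competing p satisfies p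
    x <= 1 / t. *)
Lemma largest_seminorm_has_sup x : has_sup [set p x | p in bounded_seminorm G].
Proof.
split.
  exists 0, (fun=> 0) => //; split=> //; split=> *; first by rewrite addr0.
  by rewrite mulr0.
have [t t0 Gtx] := G_absorbing x; exists t^-1 => _ [p [[_ pZ] pG] <-].
have := pG _ Gtx; rewrite pZ gtr0_norm // mulrC -ler_pdivlMr //.
by rewrite mul1r.
Qed.

Lemma le_largest_seminorm p x : bounded_seminorm G p -> p x <= N x.
Proof.
by move=> Gp; apply: (sup_upper_bound (largest_seminorm_has_sup x)); exists p.
Qed.

Lemma largest_seminorm_le x (M : R) :
  (forall p, bounded_seminorm G p -> p x <= M) -> N x <= M.
Proof.
move=> xM; apply: ge_sup; first exact: (largest_seminorm_has_sup x).1.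
by move=> _ [p Gp <-]; exact: xM.
Qed.

Lemma largest_seminorm_le1 x : G x -> N x <= 1.
Proof. by move=> Gx; apply: largest_seminorm_le => p [_]; exact. Qed.

Lemma largest_seminorm_seminorm : seminorm N.
Proof.
have ND x y : N (x + y) <= N x + N y.
  apply: largest_seminorm_le => p Gp; apply: (le_trans (Gp.1.1 x y)).
  by apply: lerD; exact: le_largest_seminorm.
have NZle a x : N (a *: x) <= `|a| * N x.
  apply: largest_seminorm_le => p Gp; rewrite Gp.1.2.
  by apply: ler_wpM2l => //; exact: le_largest_seminorm.
have N0 x : 0 <= N x.
  apply: (@le_largest_seminorm (fun=> 0)); split=> //.
  by split=> *; rewrite ?addr0 ?mulr0.
split=> // a x; apply/eqP; rewrite eq_le NZle /=.
have [->|a0] := eqVneq a 0; first by rewrite normr0 mul0r.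
(* The reverse inequality is [NZle] with scalar a^-1 at the vector a x. *)
rewrite -ler_pdivlMl ?normr_gt0 // -normfV.
by rewrite -[X in N X <= _](scalerK a0) NZle.
Qed.

End largest_seminorm.

(** * Continuous functionals and weakly open half-spaces *)

Section dual_facts.
Variables (R : realType) (X : normedModType R).

Lemma dualD (f : dual X) x y : f (x + y) = f x + f y.
Proof. exact: linearD. Qed.

Lemma dualZ (f : dual X) a x : f (a *: x) = a * f x.
Proof. exact: linearZ. Qed.

Lemma dual_bounded (f : dual X) :
  exists2 K : R, 0 < K & forall x, `|f x| <= K * `|x|.
Proof.
case: f => f fc; rewrite /dual_fun /=.
have /linear_bounded_continuous/linear_boundedP/pinfty_ex_gt0[K K0 fK] :
  continuous (f : {linear X -> R^o}) by exact: fc.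
by exists K.
Qed.

(** The weak topology is initial for [evaluation], and f is [evaluation] followed by the projection
    to coordinate f, hence weakly continuous. *)
Lemma open_dual_gt (f : dual X) (a : R) :
  open [set x : weak_space X | a < f x].
Proof.
  have pc : continuous (fun g : {ptws dual X -> R} => g f).
  exact: (@proj_continuous (dual X) (fun=> R) f).
have ec : continuous (@evaluation R X : weak_space X -> {ptws dual X -> R}).
  exact: initial_continuous.
have fc : continuous ((fun g : {ptws dual X -> R} => g f) \o
    (@evaluation R X : weak_space X -> {ptws dual X -> R})).
  by move=> x; apply: continuous_comp; [exact: ec|exact: pc].
have := @open_comp _ _ _ [set y | a < y] (fun x _ => fc x) (@open_gt _ a).
exact.
Qed.

End dual_facts.

(** * The new unit ball and the equivalence of the norms *)

Section renorming_of_sum_with_c0.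
Variables (R : realType) (X : normedModType R).
Variables (S : {linear X -> c0 R}) (T : {linear c0 R -> X}) (kS kT eps : R).
Hypotheses (TK : cancel T S) (kS0 : 0 <= kS) (kT0 : 0 <= kT).
Hypotheses (S_bounded : forall x, `|S x| <= kS * `|x|).
Hypotheses (T_bounded : forall u, `|T u| <= kT * `|u|).
Hypotheses (eps_gt0 : 0 < eps) (eps_lt1 : eps < 1).
Implicit Types (x y : X) (u v : c0 R).

(** The norm of the component of x in Z, the kernel of [S]. *)
Definition residual x : R := `|x - T (S x)|.

Definition max_norm x : R := Num.max `|S x| (residual x).

(** The test 0 < n exempts the root, which all blocks share and to which [logn] would assign
    valuation 0. *)
Definition block i : set X := [set x | [/\ `|S x| <= 1, residual x = 0
  & forall n, (0 < n)%N -> logn 2 n != i -> S x n = 0]].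

Definition thick : set X :=
  [set x | [/\ `|S x| <= 1, `|S x 0| <= 1 - eps & residual x <= 1 - eps]].

Definition generators : set X := thick `|` \bigcup_i block i.

Local Notation N := (largest_seminorm generators).

Let eps'_gt0 : 0 < 1 - eps. Proof. by rewrite subr_gt0. Qed.

Lemma residual_seminorm : seminorm residual.
Proof.
split=> [x y|a x]; rewrite /residual.
  by rewrite !linearD /= addrACA ler_normD.
by rewrite linearZ /= linearZ -scalerBr normrZ.
Qed.

Lemma norm_S_seminorm : seminorm (fun x => `|S x|).
Proof.
by split=> [x y|a x]; rewrite ?linearD ?ler_normD // linearZ normrZ.
Qed.

Lemma residualDT x u : residual (x + T u) = residual x.
Proof. by rewrite /residual !linearD /= TK addrACA subrr addr0. Qed.

Lemma residualT u : residual (T u) = 0.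
Proof. by rewrite /residual TK subrr normr0. Qed.

Lemma SDT x u : S (x + T u) = S x + u.
Proof. by rewrite linearD /= TK. Qed.

Lemma max_norm_seminorm : seminorm max_norm.
Proof.
have [SD SZ] := norm_S_seminorm; have [rD rZ] := residual_seminorm.
split=> [x y|a x]; rewrite /max_norm.
  rewrite ge_max; apply/andP; split.
    by apply: (le_trans (SD _ _)); apply: lerD; rewrite le_max lexx.
  by apply: (le_trans (rD _ _)); apply: lerD; rewrite le_max lexx orbT.
by rewrite SZ rZ maxr_pMr.
Qed.

Lemma le_norm_max_norm x : `|x| <= (1 + kT) * max_norm x.
Proof.
rewrite -[X in `|X| <= _](subrK (T (S x))) (le_trans (ler_normD _ _)) //.
rewrite mulrDl mul1r lerD //; first by rewrite le_max lexx orbT.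
by apply: (le_trans (T_bounded _)); rewrite ler_wpM2l // le_max lexx.
Qed.

Lemma max_norm_le_norm x : max_norm x <= (1 + kS + kT * kS) * `|x|.
Proof.
have Sx := S_bounded x; have x0 := normr_ge0 x.
rewrite ge_max; apply/andP; split.
  by apply: (le_trans Sx); rewrite ler_wpM2r // addrAC lerDr addr_ge0 ?mulr_ge0.
apply: (le_trans (ler_normB _ _)).
apply: (@le_trans _ _ (`|x| + kT * (kS * `|x|))).
  by rewrite lerD2l (le_trans (T_bounded _)) // ler_wpM2l.
by rewrite !mulrDl mul1r mulrA lerD2r lerDl mulr_ge0.
Qed.

Lemma generatorsN x : generators x -> generators (- x).
Proof.
have rN := seminormN x residual_seminorm.
move=> [[Sx Sx0 rx]|[i _ [Sx rx Sxi]]]; [left|right].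
  by split; rewrite ?linearN ?normrN ?rN.
exists i => //; split; rewrite ?linearN ?normrN ?rN // => n n0 ni.
by rewrite c0N Sxi ?oppr0.
Qed.

Lemma max_norm_generators x : generators x -> max_norm x <= 1.
Proof.
rewrite ge_max => -[[-> _ rx]|[i _ [-> -> _]]] //=.
by rewrite (le_trans rx) // gerBl ltW.
Qed.

(** This ball inside the generators makes them absorbing and bounds the new norm by a multiple of
    [max_norm]. *)
Lemma thick_max_norm x : max_norm x <= 1 - eps -> thick x.
Proof.
rewrite ge_max => /andP[Sx rx]; split=> //.
  by rewrite (le_trans Sx) // gerBl ltW.
by rewrite (le_trans (c0_coord_le _ _)).
Qed.

Lemma generators_absorbing x : exists2 t : R, 0 < t & generators (t *: x).
Proof.
have M0 := seminorm_ge0 x max_norm_seminorm.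
(* The added 1 keeps the divisor positive when [max_norm x] vanishes. *)
have M1 : 0 < max_norm x + 1 by rewrite ltr_wpDl.
exists ((1 - eps) / (max_norm x + 1)); first by rewrite divr_gt0.
left; apply: thick_max_norm; rewrite max_norm_seminorm.2 gtr0_norm ?divr_gt0 //.
by rewrite mulrAC ler_pdivrMr // ler_wpM2l ?ltW// ltrDl.
Qed.

Let N_seminorm : seminorm N.
Proof. exact/largest_seminorm_seminorm/generators_absorbing. Qed.

(** [max_norm] is itself one of the seminorms in the supremum defining the new norm. *)
Lemma max_norm_le_N x : max_norm x <= N x.
Proof.
apply: le_largest_seminorm; first exact: generators_absorbing.
by split; [exact: max_norm_seminorm|exact: max_norm_generators].
Qed.

Lemma N_le1 x : generators x -> N x <= 1.
Proof. exact/largest_seminorm_le1/generators_absorbing. Qed.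

Lemma N_le_max_norm x : N x <= max_norm x / (1 - eps).
Proof.
have [x0|Mx] := eqVneq (max_norm x) 0.
  suff -> : x = 0.
    rewrite -{1 2}(scale0r 0) N_seminorm.2 max_norm_seminorm.2 normr0 !mul0r //.
  apply/normr0_eq0/le_anti; rewrite normr_ge0 andbT.
  by rewrite (le_trans (le_norm_max_norm x)) // x0 mulr0.
have {}Mx : 0 < max_norm x.
  by rewrite lt0r Mx seminorm_ge0 //; exact: max_norm_seminorm.
have t0 : 0 < (1 - eps) / max_norm x by rewrite divr_gt0.
have : N (((1 - eps) / max_norm x) *: x) <= 1.
  apply: N_le1; left; apply: thick_max_norm.
  by rewrite max_norm_seminorm.2 gtr0_norm // divfK ?gt_eqF.
by rewrite N_seminorm.2 gtr0_norm // -ler_pdivlMl // invf_div mulr1.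
Qed.

Lemma N_equivalent : equivalent_norm N.
Proof.
have kTS0 : 0 < 1 + kS + kT * kS by rewrite ltr_pwDl ?mulr_ge0 // ltr_pwDl.
have kT1 : 0 < 1 + kT by rewrite ltr_pwDl.
split.
  split; [exact: N_seminorm.1|exact: N_seminorm.2|move=> x Nx0].
  apply/normr0_eq0/le_anti; rewrite normr_ge0 andbT.
  rewrite (le_trans (le_norm_max_norm x)) // pmulr_rle0 //.
  by apply: le_trans (max_norm_le_N x) _; rewrite Nx0.
exists (1 + kT)^-1, ((1 + kS + kT * kS) / (1 - eps)); split.
- by rewrite invr_gt0.
- by rewrite divr_gt0.
move=> x; split.
  rewrite ler_pdivrMl // (le_trans (le_norm_max_norm x)) //.
  by rewrite ler_pM2l //; exact: max_norm_le_N.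
rewrite (le_trans (N_le_max_norm x)) // mulrAC.
by rewrite ler_pM2r ?invr_gt0 // max_norm_le_norm.
Qed.

(** * Slices of diameter two *)

Definition modify x j (a : R) : X := x + T ((a - S x j) *: c0_unit R j).

Lemma modifyE x j (a : R) n :
  S (modify x j a) n = if n == j then a else S x n.
Proof.
rewrite /modify SDT c0D c0Z c0_unitE; case: eqP => [->|_].
  by rewrite mulr1 addrC subrK.
by rewrite mulr0 addr0.
Qed.

Lemma norm_modify x j (a : R) :
  `|S x| <= 1 -> `|a| <= 1 -> `|S (modify x j a)| <= 1.
Proof.
move=> Sx a1; apply: c0_norm_le => n; rewrite modifyE; case: ifP => // _.
exact: le_trans (c0_coord_le _ _) Sx.
Qed.

(** For fixed i this enumerates the odd multiples of 2 ^ i, that is, the infinite block i. *)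
Definition block_index i k : nat := (2 ^ i * k.*2.+1)%N.

Lemma block_index_gt0 i k : (0 < block_index i k)%N.
Proof. by rewrite muln_gt0 expn_gt0. Qed.

Lemma block_index_inj i : injective (block_index i).
Proof.
move=> k l /eqP; rewrite eqn_pmul2l ?expn_gt0 //.
by rewrite eqSS -!muln2 eqn_pmul2r // => /eqP.
Qed.

Lemma logn_block_index i k : logn 2 (block_index i k) = i.
Proof.
rewrite lognM ?expn_gt0 // pfactorK // [X in (_ + X)%N]lognE /=.
by rewrite dvdn2 /= odd_double /= addn0.
Qed.

(** A block point may be altered within its own block. Beyond the sup bound, the thick part
    constrains only root and residual, so any block serves there; block 0 is taken. *)
Lemma generators_modify x : generators x ->
  exists i, forall k a, `|a| <= 1 -> generators (modify x (block_index i k) a).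
Proof.
move=> [[Sx Sx0 rx]|[i _ [Sx rx Sxi]]].
  exists 0 => k a a1; left; split; first exact: norm_modify.
    by rewrite modifyE ltn_eqF ?block_index_gt0.
  by rewrite residualDT.
exists i => k a a1; right; exists i => //; split; first exact: norm_modify.
  by rewrite residualDT.
move=> n n0 ni; rewrite modifyE; case: eqP => [nE|_]; last exact: Sxi.
by move: ni; rewrite nE logn_block_index eqxx.
Qed.

(** Otherwise f <= s - alpha on the generators, and by symmetry |f| <= s - alpha there. A multiple
    of |f| then competes in the supremum defining the new norm, which keeps f away from s on the
    whole ball. *)
Lemma slice_meets_generators (f : dual X) (alpha : R) : 0 < alpha ->
  exists2 x, generators x & slice (unit_ball N) f alpha x.
Proof.
move=> alpha0; set s := sup (f @` unit_ball N).
have [K K0 fK] := dual_bounded f.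
have fB : has_sup (f @` unit_ball N).
  split.
    exists (f 0), 0 => //.
    by rewrite /unit_ball /= -(scale0r 0) N_seminorm.2 normr0 mul0r.
  exists (K * (1 + kT)) => _ [x Nx <-].
  rewrite (le_trans (ler_norm _)) // (le_trans (fK x)) //.
  rewrite ler_pM2l // (le_trans (le_norm_max_norm x)) //.
  by rewrite ler_piMr ?(le_trans (max_norm_le_N x)) // addr_ge0.
apply: contrapT => nex.
have fG x : generators x -> f x <= s - alpha.
  move=> Gx; rewrite leNgt; apply/negP => fx; apply: nex; exists x => //.
  by split=> //; exact: N_le1.
have fN x : f (- x) = - f x by rewrite -scaleN1r dualZ mulN1r.
have {}fG x : generators x -> `|f x| <= s - alpha.
  move=> Gx; rewrite ler_norml fG // andbT lerNl -fN.
  exact/fG/generatorsN.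
have [t t0 Gt0] := generators_absorbing 0.
have sa0 : 0 <= s - alpha by exact: le_trans (fG _ Gt0).
(* As s - alpha may be 0, alpha is halved to get a positive divisor still below s. *)
have c0 : 0 < s - alpha / 2 by lra.
suff : s <= s - alpha / 2 by lra.
apply: ge_sup; first exact: fB.1.
move=> _ [x Nx <-]; apply: (le_trans (ler_norm _)).
rewrite -[leRHS]mulr1 -ler_pdivrMl // (le_trans _ Nx) //.
apply: (@le_largest_seminorm _ _ _ generators_absorbing
  (fun x => (s - alpha / 2)^-1 * `|f x|)).
split.
  split=> [y z|a y].
    by rewrite -mulrDr ler_pM2l ?invr_gt0 // dualD ler_normD.
  by rewrite dualZ normrM mulrCA.
move=> y Gy; rewrite ler_pdivrMl // mulr1 (le_trans (fG _ Gy)) //.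
by lra.
Qed.

Lemma N_slice_diameter_two : slice_diameter_two_property N.
Proof.
move=> f alpha alpha0; apply/eqP; rewrite eq_le; apply/andP; split.
  apply: ge_ereal_sup => _ [x [Nx _] [y [Ny _] <-]]; rewrite lee_fin.
  rewrite (le_trans (seminormB x y N_seminorm)) //.
  by rewrite -[leRHS]/(1 + 1 : R) lerD.
have [x Gx [Nx fx]] := slice_meets_generators f alpha0.
have [i Gi] := generators_modify Gx.
set s := sup _ in fx.
have [K K0 fK] := dual_bounded f.
(* Half of the slack of x in the slice: coordinate j changes by at most 2, so f changes by at most 2
   |f (T e_j)|. *)
have d0 : 0 < (f x - (s - alpha)) / 2 by rewrite divr_gt0 // subr_gt0.
have fTK u : `|(sval f \o T) u| <= K * kT * `|u|.
  by rewrite (le_trans (fK _)) // -mulrA ler_pM2l.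
have [k fk] := c0_units_weakly_null (@block_index_inj i) fTK d0.
pose j := block_index i k.
have in_slice a : `|a| <= 1 -> slice (unit_ball N) f alpha (modify x j a).
  move=> a1; split; first exact/N_le1/Gi.
  have -> : f (modify x j a) = f x + (a - S x j) * f (T (c0_unit R j)).
    by rewrite /modify dualD linearZ dualZ.
  have : `|(a - S x j) * f (T (c0_unit R j))| < f x - (s - alpha).
    rewrite normrM (@le_lt_trans _ _ (2 * `|f (T (c0_unit R j))|)) //.
      rewrite ler_wpM2r // (le_trans (ler_normB _ _)) //.
      rewrite -[leRHS]/(1 + 1 : R) lerD // (le_trans (c0_coord_le _ _)) //.
      have := max_norm_generators Gx; rewrite ge_max => /andP[] //.
    by rewrite mulrC -ltr_pdivlMr.
  by rewrite ltr_norml => /andP[]; rewrite -/s; lra.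
apply: le_ereal_sup_tmp; exists (N (modify x j 1 - modify x j (-1)))%:E.
  exists (modify x j 1); first by apply: in_slice; rewrite normr1.
  by exists (modify x j (-1)) => //; apply: in_slice; rewrite normrN1.
rewrite lee_fin (le_trans _ (max_norm_le_N _)) // le_max; apply/orP; left.
rewrite (le_trans _ (c0_coord_le _ j)) // linearB c0D c0N !modifyE eqxx.
by rewrite opprK -[1 + 1]/(2 : R) ger0_norm.
Qed.

(** * The (r, s)-square property *)

Lemma NT_c0_unit j : (0 < j)%N -> N (T (c0_unit R j)) = 1.
Proof.
move=> j0; apply/eqP; rewrite eq_le; apply/andP; split.
  apply: N_le1; right; exists (logn 2 j) => //; split.
  - by rewrite TK norm_c0_unit.
  - exact: residualT.
  move=> n n0 nj; rewrite TK c0_unitE (negbTE (_ : n != j)) //.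
  by apply: contra nj => /eqP ->.
by rewrite (le_trans _ (max_norm_le_N _)) // /max_norm TK norm_c0_unit le_max lexx.
Qed.

Lemma N_rs_square (r s : R) : 0 < r -> r <= 1 - eps -> 0 < s -> s < 1 ->
  rs_square r s N.
Proof.
move=> r0 r1 s0 s1 m x Nx.
have s1' : 0 < 1 - s by rewrite subr_gt0.
have : \forall n \near \oo, forall i, `|S (x i) n| < 1 - s.
  apply: filter_forall => i.
  have /cvgr0Pnorm_lt/(_ _ s1') := c0_cvg (S (x i)); exact.
(* The successor keeps j away from the root. *)
move=> [n _ xn]; pose j := n.+1.
exists (T (c0_unit R j)); first exact: NT_c0_unit.
have r_le1 : r <= 1 by rewrite (le_trans r1) // gerBl ltW.
have Mx i : max_norm (x i) <= 1 by rewrite -(Nx i) max_norm_le_N.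
have Sx i k : `|S (x i) k| <= 1.
  by apply: (le_trans (c0_coord_le _ _)); have := Mx i; rewrite ge_max => /andP[].
(* A bound for all |t| <= s covers both signs. At j, |r x_j| <= 1 - s and |t| <= s add up to at most
   1; root and residual are untouched by e_j and at most r <= 1 - eps. *)
have key i (t : R) : `|t| <= s -> N (r *: x i + t *: T (c0_unit R j)) <= 1.
  move=> ts; apply: N_le1; left.
  have SE k : S (r *: x i + t *: T (c0_unit R j)) k =
      r * S (x i) k + t * (k == j)%:R.
    by rewrite -linearZ SDT c0D linearZ c0Z c0Z c0_unitE.
  split.
  - apply: c0_norm_le => k; rewrite SE; case: eqP => [->|_].
      rewrite mulr1 (le_trans (ler_normD _ _)) // -(subrK s 1) lerD //.
      rewrite normrM gtr0_norm // (le_trans _ (ltW (xn j _ i))) //=.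
      by rewrite ler_piMl.
    by rewrite mulr0 addr0 normrM gtr0_norm // mulr_ile1 // ltW.
  - rewrite SE mulr0 addr0 normrM gtr0_norm //.
    by rewrite (le_trans _ r1) // ler_piMr // ltW.
  - rewrite -linearZ residualDT residual_seminorm.2 gtr0_norm //.
    rewrite (le_trans _ r1) // ler_piMr ?(ltW r0) //.
    by have := Mx i; rewrite ge_max => /andP[].
move=> i; split; first by apply: key; rewrite gtr0_norm.
by rewrite -scaleNr; apply: key; rewrite normrN gtr0_norm.
Qed.


(** * Weakly open sets of small diameter *)

Lemma coord_continuous n :
  continuous ((c0_coord n \o S : {scalar X}) : X -> R).
Proof.
apply: (@bounded_linear_continuous _ _ _ (c0_coord n \o S : {linear X -> R^o})).
apply/linear_boundedP; exists kS; split; first by rewrite num_real.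
move=> r kSr x; apply: (le_trans (c0_coord_le _ _)).
by rewrite (le_trans (S_bounded x)) // ler_wpM2r // ltW.
Qed.

Definition coord_dual n : dual X :=
  exist (fun f : {scalar X} => continuous (f : X -> R)) _ (@coord_continuous n).

(** The index 2 ^ i represents block i. The k lower bounds add up to 1 - eta, nearly all that the
    l_1-sum of the blocks allows. *)
Definition weak_box k (eta : R) : set X := [set x | 1 - eta < S x 0 /\
  forall i : 'I_k, (1 - eta) / k%:R < S x (2 ^ i)%N].

Lemma open_weak_box k eta : open (weak_box k eta : set (weak_space X)).
Proof.
rewrite openE => x [x0 xi].
have nx0 : nbhs (x : weak_space X) [set y : weak_space X | 1 - eta < S y 0].
  exact: (open_nbhs_nbhs (conj (open_dual_gt (coord_dual 0) (1 - eta)) x0)).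
have nxi : nbhs (x : weak_space X)
    [set y : weak_space X | forall i : 'I_k, (1 - eta) / k%:R < S y (2 ^ i)%N].
  apply: (@filter_forall _ _ (fun (i : 'I_k) (y : weak_space X) =>
    (1 - eta) / k%:R < S y (2 ^ i)%N) (nbhs (x : weak_space X)) _) => i.
  exact: (open_nbhs_nbhs (conj
    (open_dual_gt (coord_dual (2 ^ i)%N) ((1 - eta) / k%:R)) (xi i))).
exact: filterI nx0 nxi.
Qed.

(** On the thick part the sum is at most (1 - eps) + eps; on the blocks the residual vanishes. Hence
    a root near 1 forces a small residual. *)
Lemma bounded_seminorm_residual :
  bounded_seminorm generators (fun x => `|S x 0| + eps * residual x).
Proof.
have [rD rZ] := residual_seminorm; split.
  split=> [x y|a x].
    rewrite linearD c0D addrACA lerD ?ler_normD // -mulrDr.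
    by rewrite ler_pM2l.
  by rewrite linearZ c0Z normrM rZ mulrCA -mulrDr.
move=> x [[_ Sx0 rx]|[i _ [Sx rx _]]].
  have : eps * residual x <= eps * 1.
    by rewrite ler_pM2l // (le_trans rx) // gerBl ltW.
  by lra.
by rewrite rx mulr0 addr0 (le_trans (c0_coord_le _ _)).
Qed.

(* A block other than that of n vanishes at n and meets at most one of the
   coordinates 2 ^ i, while the block of n meets none of those in the sum. The
   weight k / eps of the root makes the bound hold on the thick part as well. *)
Lemma bounded_seminorm_coord k n : (0 < n)%N ->
  bounded_seminorm generators (fun x => (k%:R / eps + 1)^-1 *
    (k%:R / eps * `|S x 0| + \sum_(i < k | i != logn 2 n :> nat) `|S x (2 ^ i)%N|
     + `|S x n|)).
Proof.
move=> n0; set A := k%:R / eps.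
have A0 : 0 <= A by rewrite divr_ge0 // ltW.
have A1 : 0 < A + 1 by rewrite ltr_wpDl.
split.
  split=> [x y|a x].
    rewrite -mulrDr ler_pM2l ?invr_gt0 // addrACA linearD c0D.
    rewrite lerD ?ler_normD // [leRHS]addrACA -mulrDr -big_split /= lerD //.
      by rewrite ler_wpM2l // ler_normD.
    by apply: ler_sum => i _; rewrite ler_normD.
  rewrite linearZ !c0Z !normrM [RHS]mulrCA; congr (_ * _).
  rewrite !mulrDr [A * _]mulrCA; congr (_ + _ + _); rewrite mulr_sumr.
  by apply: eq_bigr => i _; rewrite c0Z normrM.
move=> x Gx; rewrite ler_pdivrMl // mulr1.
have Sx : `|S x| <= 1.
  by have := max_norm_generators Gx; rewrite ge_max => /andP[].
have Sx1 j : `|S x j| <= 1 by rewrite (le_trans (c0_coord_le _ _)).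
case: Gx => [[_ Sx0 _]|[b _ [_ _ Sxb]]].
  rewrite lerD //.
  have : \sum_(i < k | i != logn 2 n :> nat) `|S x (2 ^ i)%N| <= k%:R.
    rewrite -[k in leRHS]card_ord -sumr_const
      [leRHS](bigID (fun i : 'I_k => i != logn 2 n :> nat)) /=.
    rewrite -[leLHS]addr0 lerD ?sumr_ge0 //.
    by apply: ler_sum => i _.
  have : A * `|S x 0| <= A * (1 - eps) by rewrite ler_wpM2l.
  have : A * (1 - eps) = A - k%:R by rewrite mulrBr mulr1 divfK ?gt_eqF.
  by lra.
have Sxi i : i != b -> S x (2 ^ i)%N = 0.
  by move=> ib; apply: Sxb; rewrite ?expn_gt0 // pfactorK.
rewrite -addrA lerD ?ler_piMr //.
have [bn|bn] := eqVneq b (logn 2 n).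
  rewrite big1 ?add0r // => i ib; rewrite Sxi ?normr0 //.
  by rewrite bn.
rewrite (Sxb n) // 1?eq_sym // normr0 addr0.
rewrite (@le_trans _ _ (\sum_(i < k) `|S x (2 ^ i)%N|)) //.
  rewrite [leRHS](bigID (fun i : 'I_k => i != logn 2 n :> nat)) /=.
  by rewrite lerDl sumr_ge0.
rewrite (bigID (fun i : 'I_k => i == b :> nat)) /=.
rewrite (big_ord1_eq _ (fun i => `|S x (2 ^ i)%N|)) big1 ?addr0.
  by case: ifP.
by move=> i ib; rewrite Sxi ?normr0.
Qed.

Section weak_box_of_small_diameter.
Variable k : nat.
Hypothesis k_gt0 : (0 < k)%N.

(** Chosen so that the loss at the root, whose weight in [bounded_seminorm_coord] is k / eps, is (k
    / eps) eta = 1 / k. *)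
Let eta : R := eps / (k%:R * k%:R).

Let k1 : 1 <= k%:R :> R. Proof. by rewrite ler1n. Qed.

Let kR0 : 0 < k%:R :> R. Proof. exact: lt_le_trans k1. Qed.

Let eta0 : 0 < eta. Proof. by rewrite divr_gt0 // mulr_gt0. Qed.

Let eta_eps_le : eta / eps <= k%:R^-1.
Proof.
rewrite /eta mulrAC divff ?gt_eqF // div1r invfM ler_piMl ?invr_ge0 ?ler0n //.
by rewrite invf_le1.
Qed.

Let eta_le : eta <= k%:R^-1.
Proof.
apply: le_trans eta_eps_le; rewrite ler_pdivlMr // ler_piMr //; exact: ltW.
Qed.

Let eta_le1 : eta <= 1.
Proof. by rewrite (le_trans eta_le) // invf_le1. Qed.

Section points.
Variable x : X.
Hypotheses (Nx : N x <= 1) (Wx : weak_box k eta x).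

Lemma weak_box_root_le1 : S x 0 <= 1.
Proof.
have := le_trans (max_norm_le_N x) Nx; rewrite ge_max => /andP[Sx _].
by rewrite (le_trans (ler_norm _)) // (le_trans (c0_coord_le _ _)).
Qed.

Lemma weak_box_residual : residual x <= k%:R^-1.
Proof.
apply: le_trans eta_eps_le; rewrite ler_pdivlMr //.
have := le_trans (le_largest_seminorm generators_absorbing x
  bounded_seminorm_residual) Nx.
have := ler_norm (S x 0); have := Wx.1; rewrite /=; lra.
Qed.

(** The root and the other blocks exhaust the bound of [bounded_seminorm_coord] up to three errors,
    each at most 1 / k: the loss at the root, eta, and one omitted term a. *)
Lemma weak_box_coord n : (0 < n)%N -> `|S x n| <= 3 / k%:R.
Proof.
move=> n0; have := le_trans (le_largest_seminorm generators_absorbing x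
  (bounded_seminorm_coord k n0)) Nx.
set A := k%:R / eps.
have A0 : 0 < A by rewrite divr_gt0.
rewrite ler_pdivrMl ?mulr1; last by rewrite ltr_pwDl.
set a := (1 - eta) / k%:R.
have a0 : 0 <= a by rewrite divr_ge0 ?ler0n ?subr_ge0.
have ak : a <= k%:R^-1 by rewrite ler_piMl ?invr_ge0 ?ler0n // gerBl ltW.
have sum_a : 1 - eta - a <= \sum_(i < k | i != logn 2 n :> nat) `|S x (2 ^ i)%N|.
  apply: (@le_trans _ _ (\sum_(i < k | i != logn 2 n :> nat) a)); last first.
    by apply: ler_sum => i _; rewrite (le_trans (ltW (Wx.2 i))) // ler_norm.
  (* At most one term is dropped, and none if the valuation of n is at least k. *)
  have : \sum_(i < k) a = 1 - eta.
    by rewrite sumr_const card_ord -[_ *+ _]mulr_natr divfK ?gt_eqF.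
  rewrite (bigID (fun i : 'I_k => i == logn 2 n :> nat)) /=.
  rewrite (big_ord1_eq _ (fun=> a)).
  by case: ifP => _; lra.
have Ax : A * (1 - eta) <= A * `|S x 0|.
  by rewrite ler_pM2l // (le_trans (ltW Wx.1)) // ler_norm.
have Aeta : A * (1 - eta) = A - k%:R^-1.
  by rewrite mulrBr mulr1 /A /eta; field; rewrite !gt_eqF.
have := eta_le; lra.
Qed.

End points.

Lemma weak_box_distance x y : N x <= 1 -> weak_box k eta x ->
  N y <= 1 -> weak_box k eta y -> N (x - y) <= 6 / k%:R / (1 - eps).
Proof.
move=> Nx Wx Ny Wy; apply: (le_trans (N_le_max_norm _)).
rewrite ler_pM2r ?invr_gt0 // ge_max.
have ik0 : 0 < k%:R^-1 :> R by rewrite invr_gt0.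
apply/andP; split.
  (* At the root both values lie between 1 - eta and 1; elsewhere two bounds 3 / k add up. *)
  apply: c0_norm_le => -[|n]; rewrite linearB c0D c0N.
    have := weak_box_root_le1 Nx; have := weak_box_root_le1 Ny.
    have := Wx.1; have := Wy.1; have := eta_le; rewrite /= ler_norml.
    by move=> *; apply/andP; split; lra.
  apply: (le_trans (ler_normB _ _)).
  have := weak_box_coord Nx Wx (ltn0Sn n).
  have := weak_box_coord Ny Wy (ltn0Sn n).
  by lra.
apply: (le_trans (seminormB x y residual_seminorm)).
have := weak_box_residual Nx Wx; have := weak_box_residual Ny Wy; lra.
Qed.

Lemma weak_box_nonempty : unit_ball N `&` weak_box k eta !=set0.
Proof.
(* The witness is the average of the k block points e_0 + e_j with j = 2 ^ i: its root is 1 and each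
   chosen coordinate is 1 / k. *)
pose g i : X := T (c0_unit R 0 + c0_unit R (2 ^ i)%N).
have Ng i : N (g i) <= 1.
  apply: N_le1; right; exists i => //; split; last 1 first.
  - move=> n n0 ni; rewrite TK c0D !c0_unitE gtn_eqF // add0r.
    rewrite (negbTE (_ : (n != 2 ^ i)%N)) //.
    by apply: contra ni => /eqP ->; rewrite pfactorK.
  - rewrite TK; apply: c0_norm_le => n; rewrite c0D !c0_unitE.
    have [->|_] := eqVneq n 0; last first.
      by rewrite add0r; case: eqP; rewrite ?normr1 ?normr0.
    by rewrite (negbTE (_ : (0 != 2 ^ i)%N)) ?addr0 ?normr1 // ltn_eqF ?expn_gt0.
  - exact: residualT.
have SE n : S (k%:R^-1 *: \sum_(i < k) g i) n =
    k%:R^-1 * \sum_(i < k) ((n == 0)%:R + (n == 2 ^ i)%N%:R).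
  rewrite linearZ c0Z linear_sum -[X in _ * X]/(c0_coord n _) linear_sum.
  congr (_ * _); apply: eq_bigr => i _.
  by rewrite /= TK.
exists (k%:R^-1 *: \sum_(i < k) g i); split; last split.
- rewrite /unit_ball /= N_seminorm.2 ger0_norm ?invr_ge0 ?ler0n //.
  rewrite ler_pdivrMl // mulr1 (le_trans (seminorm_sum _ N_seminorm)) //.
  rewrite -[k in leRHS]card_ord -sumr_const.
  by apply: ler_sum.
- rewrite SE (eq_bigr (fun=> 1)) => [|i _].
    by rewrite sumr_const card_ord mulVf ?gt_eqF // gtrBl.
  by rewrite eqxx ltn_eqF ?expn_gt0 // addr0.
- move=> j; rewrite SE (bigD1 j) //= big1 => [|i ij].
    rewrite eqxx gtn_eqF ?expn_gt0 // add0r addr0 mulr1.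
    by rewrite -[ltRHS]mul1r ltr_pM2r ?invr_gt0 // gtrBl.
  rewrite gtn_eqF ?expn_gt0 // eqn_exp2l // (negbTE (_ : j != i :> nat)) ?addr0 //.
  by rewrite eq_sym.
Qed.

End weak_box_of_small_diameter.

Lemma N_small_relatively_weakly_open_sets : small_relatively_weakly_open_sets N.
Proof.
move=> delta delta0; pose c : R := 6 / (1 - eps) / delta.
have c0 : 0 < c by rewrite !divr_gt0.
(* This k exceeds [c], so that 6 / k / (1 - eps) < delta. *)
pose k := (Num.truncn c).+1.
exists (unit_ball N `&` weak_box k (eps / (k%:R * k%:R))); split.
- by exists (weak_box k (eps / (k%:R * k%:R))) => //; exact: open_weak_box.
- exact: weak_box_nonempty.
apply: (@le_lt_trans _ _ (6 / k%:R / (1 - eps))%:E).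
  apply: ge_ereal_sup => _ [x [Nx Wx] [y [Ny Wy] <-]]; rewrite lee_fin.
  exact: weak_box_distance.
rewrite lte_fin mulrAC ltr_pdivrMr // [ltRHS]mulrC -ltr_pdivrMr //.
exact: truncnS_gt.
Qed.

End renorming_of_sum_with_c0.

(** * From a complemented copy of [c0] to the operators [S] and [T], and conclusion *)

Lemma complemented_c0_retraction (R : realType) (X : normedModType R) :
  (exists Y : set X,
    complemented_subspace Y /\ isomorphic_to_subspace (c0 R) Y) ->
  exists (S : {linear X -> c0 R}) (T : {linear c0 R -> X}) (kS kT : R),
    [/\ cancel T S, 0 <= kS, 0 <= kT, forall x, `|S x| <= kS * `|x|
      & forall u, `|T u| <= kT * `|u|].
Proof.
move=> [Y [[P [Pc PP PY]] [T [TY [c [C [c_gt0 C_gt0 cTC]]]]]]].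
have T_inj u v : T u = T v -> u = v.
  move=> Tuv; apply/eqP; rewrite -subr_eq0 -normr_le0.
  by have := (cTC (u - v)).1; rewrite linearB Tuv subrr normr0 pmulr_rle0.
(* [S] is the inverse of [T] after the projection [P]. From c |S x| <= |T (S x)| = |P x| <= K |x|
   comes its bound K / c. *)
have /choice[S TS] x : exists u, T u = P x.
  have : range T (P x) by rewrite TY -PY; exists x.
  by move=> [u _ <-]; exists u.
have S_linear : linear S.
  by move=> a x y; apply: T_inj; rewrite linearP !TS linearP.
have TK : cancel T S.
  move=> u; apply: T_inj; rewrite TS.
  have : range P (T u) by rewrite PY -TY; exists u.
  by move=> [x _ <-]; rewrite PP.
have /linear_bounded_continuous/linear_boundedP/pinfty_ex_gt0[K K0 PK] := Pc.
pose S' : {linear X -> c0 R} :=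
  HB.pack S (GRing.isLinear.Build _ _ _ _ _ S_linear).
exists S', T, (K / c), C; split=> //; [by rewrite divr_ge0 ?ltW|exact: ltW| |].
- move=> x; rewrite mulrAC ler_pdivlMr // mulrC.
  by apply: (le_trans (cTC (S x)).1); rewrite TS PK.
- by move=> u; exact: (cTC u).2.
Qed.

Theorem theorem1p2 (R : realType) (X : completeNormedModType R)
    (hX : exists Y : set X,
        complemented_subspace Y /\ isomorphic_to_subspace (c0 R) Y)
    (eps : R) (eps_gt0 : 0 < eps) (eps_lt1 : eps < 1) :
  exists N : X -> R,
    [/\ equivalent_norm N,
        slice_diameter_two_property N,
        small_relatively_weakly_open_sets N
      & forall r s : R,
          0 < r -> r < (1 - eps) / (1 + eps) ->
          0 < s -> s < (1 - eps) / (1 + eps) ->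
          rs_square r s N].
Proof.
have [S [T [kS [kT [TK kS0 kT0 S_bounded T_bounded]]]]] :=
  complemented_c0_retraction hX.
(* The required r and s lie in the range r <= 1 - eps, s < 1 of [N_rs_square]. *)
have ratio_le : (1 - eps) / (1 + eps) <= 1 - eps.
  have eps1 : 1 <= 1 + eps by rewrite lerDl ltW.
  by rewrite ler_pdivrMr ?(lt_le_trans ltr01) // ler_peMr // subr_ge0 ltW.
exists (largest_seminorm (generators S T eps)); split.
- exact: N_equivalent S_bounded T_bounded _ _.
- exact: N_slice_diameter_two T_bounded _ _.
- exact: N_small_relatively_weakly_open_sets S_bounded T_bounded _ _.
- move=> r s r0 r1 s0 s1; apply: N_rs_square => //.
    by rewrite (le_trans (ltW r1)).
  by rewrite (lt_le_trans s1) // (le_trans ratio_le) // gerBl ltW.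
Qed.
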